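(* Let $\ell\ge 1$, let $(\xi_k)_{k=-\infty}^{\infty}$ be an i.i.d. sequence of real random variables, let $f:\mathbb R^\ell\to\mathbb R$ be measurable, and let $X_k=f(\xi_k,\dots,\xi_{k+\ell-1})$, $k\in\mathbb Z$, be the corresponding $\ell$-block factor, assumed to have finite variance. Let $S_n:=\sum_{i=1}^n X_i$ and $\sigma^2:=\lim_{n\to\infty}n^{-1}\operatorname{Var}(S_n)$. If $\sigma^2=0$, then there exists a measurable function $g:\mathbb R^{\ell-1}\to\mathbb R$ such that for every $n\ge1$, $$S_n-\mathbb E S_n=g(\xi_{n+1},\dots,\xi_{n+\ell-1})-g(\xi_1,\dots,\xi_{\ell-1})\quad\text{a.s.}$$
   Context: A sequence $(X_k)_{k=-\infty}^\infty$ is an $\ell$-block factor if there is an i.i.d. sequence $(\xi_k)_{k=-\infty}^\infty$ and a measurable function $f:\mathbb R^\ell\to\mathbb R$ such that $X_k=f(\xi_k,\dots,\xi_{k+\ell-1})$ for all $k$. Such a sequence is strictly stationary, and $(X_k)_{k\le 0}$ is independent of $(X_k)_{k\ge \ell}$; when $X_k$ has finite variance ($\mathbb E X_k^2<\infty$), the limit defining $\sigma^2$ exists. When $\ell=1$, $\mathbb R^{\ell-1}=\mathbb R^0$ is a single point and a function $g$ on it is a constant. *)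

(* Defs.v *)
From HB Require Import structures.
From mathcomp Require Import all_boot all_order all_algebra finmap.
From mathcomp Require Import all_classical all_reals all_analysis.

Set Implicit Arguments.
Unset Strict Implicit.
Unset Printing Implicit Defensive.

Import Order.TTheory GRing.Theory Num.Theory.
Import numFieldNormedType.Exports.

Local Open Scope classical_set_scope.
Local Open Scope ring_scope.

Definition mutually_independent d (T : measurableType d) (R : realType)
    (P : probability T R) (I : choiceType) (xi : I -> {RV P >-> R}) : Prop :=
  forall (J : {fset I}) (A : I -> set R),
    (forall i, i \in J -> measurable (A i)) ->
    P (\bigcap_(i in [set` J]) (xi i @^-1` A i)) =
    (\prod_(i <- J) P (xi i @^-1` A i))%E.

Definition identically_distributed d (T : measurableType d) (R : realType)
    (P : probability T R) (I : Type) (xi : I -> {RV P >-> R}) : Prop :=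
  forall (i j : I) (A : set R), measurable A ->
    distribution P (xi i) A = distribution P (xi j) A.

Definition iid d (T : measurableType d) (R : realType)
    (P : probability T R) (I : choiceType) (xi : I -> {RV P >-> R}) : Prop :=
  mutually_independent xi /\ identically_distributed xi.

Section block_factors.
Context d (T : measurableType d) (R : realType) (P : probability T R).

(* (xi_k, ..., xi_(k+m-1)); for m = 0 this is the unique point of R^0. *)
Definition window (xi : int -> {RV P >-> R}) (m : nat) (k : int) (w : T) :
    m.-tuple R :=
  [tuple xi (k + i%:Z) w | i < m].

Definition block_factor (l : nat) (f : l.-tuple R -> R)
    (xi : int -> {RV P >-> R}) (k : int) (w : T) : R :=
  f (window xi l k w).

Definition partial_sum (X : int -> T -> R) (n : nat) (w : T) : R :=
  \sum_(1 <= i < n.+1) X i%:Z w.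

Definition finite_variance (Y : T -> R) : Prop :=
  ('E_P[fun w => (Y w ^+ 2)%R] < +oo)%E.

(* limn returns a default value on a divergent sequence; for a block factor with
   finite variance the limit exists, so that value never intervenes. *)
Definition limit_variance (X : int -> T -> R) : \bar R :=
  limn (fun n : nat => ((n%:R^-1)%:E * 'V_P[partial_sum X n])%E).

End block_factors.

Arguments finite_variance {d T R} P Y.
Arguments limit_variance {d T R} P X.

(* Main.v *)
(* Integrating out the last coordinates of f one after the other splits the
   block factor as X_k = c + D_k + u(xi_k, ..) - u(xi_(k+1), ..), where D_k is a
   function of xi_k, ..., xi_(k+l-1) whose mean given all xi_j with j < k+l-1
   vanishes, and u depends on l-1 coordinates only. The D_k are orthogonal and
   the u-terms telescope, so Var(S_n) = n Var(D_0) + O(sqrt n) and sigma^2 is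
   Var(D_0). If it vanishes, then so do all D_k almost surely, and g = -u. *)
Require Import Defs.
From HB Require Import structures.
From mathcomp Require Import all_boot all_order all_algebra finmap.
From mathcomp Require Import all_classical all_reals all_analysis.
From mathcomp Require Import measurable_realfun ring lra zify.
Import Order.TTheory GRing.Theory Num.Theory.
Import numFieldNormedType.Exports.
Local Open Scope classical_set_scope.
Local Open Scope ring_scope.

Set Implicit Arguments.
Unset Strict Implicit.
Unset Printing Implicit Defensive.

(** * Selecting and appending coordinates of tuples *)

Definition reindex_tuple (A : Type) m n (s : 'I_m -> 'I_n) (x : n.-tuple A) :
  m.-tuple A := [tuple tnth x (s i) | i < m].

Definition snoc (A : Type) n (x : n.-tuple A) (y : A) : n.+1.-tuple A :=
  [tuple oapp (tnth x) y (unlift ord_max i) | i < n.+1].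

Definition tinit (A : Type) n : n.+1.-tuple A -> n.-tuple A :=
  reindex_tuple (lift ord_max).

Definition ttail (A : Type) n : n.+1.-tuple A -> n.-tuple A :=
  reindex_tuple (lift ord0).

Lemma tinit_snoc (A : Type) n (x : n.-tuple A) y : tinit (snoc x y) = x.
Proof.
by apply: eq_from_tnth => i; rewrite !tnth_mktuple liftK.
Qed.

(** Used for two windows with the same right end: the common last coordinate is split off from both
    at once. *)
Lemma reindex_snoc (A : Type) m n (s : 'I_m.+1 -> 'I_n.+1) (s' : 'I_m -> 'I_n)
    (x : n.-tuple A) y : s ord_max = ord_max ->
  (forall i, s (lift ord_max i) = lift ord_max (s' i)) ->
  reindex_tuple s (snoc x y) = snoc (reindex_tuple s' x) y.
Proof.
move=> sM sL; apply: eq_from_tnth => i; rewrite !tnth_mktuple.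
case: (unliftP ord_max i) => [j|] ->.
  by rewrite sL liftK /= tnth_mktuple.
by rewrite sM unlift_none.
Qed.

Lemma ttail_tinit (A : Type) n (x : n.+2.-tuple A) :
  ttail (tinit x) = tinit (ttail x).
Proof.
apply: eq_from_tnth => i; rewrite !tnth_mktuple; congr tnth.
by apply/ord_inj; rewrite !(lift_max, lift0).
Qed.

(** * The product sigma-algebra on tuples *)

Section measurable_tuple_ops.
Context d (S : measurableType d).

Lemma measurable_reindex_tuple m n (s : 'I_m -> 'I_n) :
  measurable_fun [set: n.-tuple S] (@reindex_tuple S m n s).
Proof.
apply/measurable_fun_tnthP => i.
rewrite (_ : _ \o _ = fun x => tnth x (s i)); first exact: measurable_tnth.
by apply/funext => x /=; rewrite tnth_mktuple.
Qed.

Lemma measurable_snoc d' (U : measurableType d') n (f : U -> n.-tuple S)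
    (g : U -> S) : measurable_fun setT f -> measurable_fun setT g ->
  measurable_fun setT (fun t => snoc (f t) (g t)).
Proof.
move=> mf mg; apply/measurable_fun_tnthP => i.
case: (unliftP ord_max i) => [j|] ->.
  rewrite (_ : _ \o _ = (fun x => tnth x j) \o f).
    by apply: measurableT_comp => //; exact: measurable_tnth.
  by apply/funext => x /=; rewrite tnth_mktuple liftK.
rewrite (_ : _ \o _ = g)//.
by apply/funext => x /=; rewrite tnth_mktuple unlift_none.
Qed.

(** The sides are indexed by [nat] so that one family [A] serves windows of length [n] and of length
    [n.+1]. *)
Definition rect n (A : nat -> set S) : set (n.-tuple S) :=
  [set x | forall i : 'I_n, A i (tnth x i)].

Definition rects n : set (set (n.-tuple S)) :=
  [set B | exists2 A, (forall i, measurable (A i)) & B = rect (n:=n) A].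
Arguments rects : clear implicits.

Lemma measurable_rect n A : (forall i, measurable (A i)) ->
  measurable (rect (n:=n) A).
Proof.
move=> mA.
rewrite (_ : rect _ =
    \bigcap_(i in [set: 'I_n]) ((fun x => tnth x i) @^-1` A i)).
  apply: fin_bigcap_measurable => // i _; rewrite -[X in measurable X]setTI.
  exact: measurable_tnth.
by apply/seteqP; split=> [x Ax i _|x Ax i]; exact: Ax.
Qed.

(** The product sigma-algebra is generated by preimages under single coordinates, and such a
    preimage is a rectangle whose other sides are [setT]. *)
Lemma measurable_rects n : measurable = <<s rects n >>.
Proof.
apply/seteqP; split; last first.
  apply: smallest_sub; first exact: sigma_algebra_measurable.
  by move=> _ [A mA ->]; exact: measurable_rect.
apply: smallest_sub; first exact: smallest_sigma_algebra.
move=> B; rewrite -bigcup_seq => -[i _ [A mA <-]].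
apply: sub_sigma_algebra; exists (fun j : nat => if j == i then A else setT).
  by move=> j; case: ifP.
apply/seteqP; split=> [x [_ xA] j|x /(_ i)]; last by rewrite eqxx.
by case: eqP => // /val_inj ->.
Qed.

Lemma setI_closed_rects n : setI_closed (rects n).
Proof.
move=> _ _ [A mA ->] [B mB ->]; exists (fun i => A i `&` B i).
  by move=> i; exact: measurableI.
by apply/seteqP; split=> [x [Ax Bx] i|x ABx]; [split|split=> i; case: (ABx i)].
Qed.

(** Dynkin's argument: rectangles are closed under intersection, generate the measurable sets and
    include the whole space, so finite measures that agree on them are equal. *)
Lemma pushforward_rects_unique n (R : realType) d1 d2 (U1 : measurableType d1)
    (U2 : measurableType d2) (m1 : {measure set U1 -> \bar R})
    (m2 : {measure set U2 -> \bar R}) (f1 : U1 -> n.-tuple S)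
    (f2 : U2 -> n.-tuple S) :
  measurable_fun setT f1 -> measurable_fun setT f2 ->
  (forall A, (forall i, measurable (A i)) ->
    m1 (f1 @^-1` rect (n:=n) A) = m2 (f2 @^-1` rect (n:=n) A)) ->
  (m1 setT < +oo)%E ->
  forall B, measurable B -> pushforward m1 f1 B = pushforward m2 f2 B.
Proof.
move=> mf1 mf2 m12 m1T B mB.
(* The measure structure on a pushforward depends on the measurability proof [mf1], so the instance
   is named in full. *)
pose p1 : {measure set (n.-tuple S) -> \bar R} :=
  measure_function_pushforward__canonical__measure_function_Measure m1 mf1.
pose p2 : {measure set (n.-tuple S) -> \bar R} :=
  measure_function_pushforward__canonical__measure_function_Measure m2 mf2.
apply: (@measure_unique _ _ _ (rects n) (fun=> setT) _ _ _ _ p1 p2) => //.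
- exact: measurable_rects.
- exact: setI_closed_rects.
- by move=> _; exists (fun=> setT) => //; apply/seteqP; split.
- by apply/seteqP; split=> // x _; exists 0%N.
- by move=> _ [A mA ->]; exact: m12.
Qed.

End measurable_tuple_ops.

(** * Laws of windows of an i.i.d. sequence *)

Section windows.
Context d (T : measurableType d) (R : realType) (P : probability T R).
Variable xi : int -> {RV P >-> R}.

Local Notation mu := (distribution P (xi 0)).

Lemma measurable_window m k :
  measurable_fun [set: T] (window xi m k : T -> m.-tuple R).
Proof.
apply/measurable_fun_tnthP => i.
rewrite (_ : _ \o _ = xi (k + i%:Z)); first exact: measurable_funPT.
by apply/funext => w /=; rewrite tnth_mktuple.
Qed.

Lemma window_reindex m n (k k' : int) (s : 'I_m -> 'I_n) w :
  (forall i : 'I_m, k' + (i : nat)%:Z = k + (s i : nat)%:Z) ->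
  window xi m k' w = reindex_tuple s (window xi n k w).
Proof.
by move=> e; apply: eq_from_tnth => i; rewrite !tnth_mktuple e.
Qed.

Lemma tinit_window n k w : tinit (window xi n.+1 k w) = window xi n k w.
Proof.
by apply/esym/window_reindex => i; rewrite lift_max.
Qed.

Lemma ttail_window n k w : ttail (window xi n.+1 k w) = window xi n (k + 1) w.
Proof.
by apply/esym/window_reindex => i; rewrite lift0 -addrA.
Qed.

Hypothesis xi_iid : iid xi.

Lemma window_rect n k (A : nat -> set R) : (forall i, measurable (A i)) ->
  P (window xi n k @^-1` rect (n:=n) A) = (\prod_(i < n) mu (A i))%E.
Proof.
move=> mA; have [ind idd] := xi_iid.
pose J : {fset int} := [fset (k + i%:Z)%R | i in iota 0 n]%fset.
have kK (i : nat) : absz (k + i%:Z - k)%R = i by rewrite addrC addKr.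
(* [absz (j - k)] recovers the position in the window from the index [j]. *)
have := ind J (fun j => A (absz (j - k)%R)) (fun j _ => mA _).
rewrite big_imfset /=; last by move=> i j _ _ /addrI [].
rewrite (_ : \bigcap_(_ in _) _ = window xi n k @^-1` rect (n:=n) A).
  move=> ->; rewrite -(big_mkord xpredT (fun i => mu (A i))) /index_iota subn0.
  rewrite undup_id ?iota_uniq //; apply: eq_bigr => i _; rewrite kK.
  exact: idd.
apply/seteqP; split=> [w /= JA i|w /= WA j].
  have := JA (k + (i : nat)%:Z); rewrite /= tnth_mktuple kK; apply.
  by apply/imfsetP; exists (i : nat) => //=; rewrite mem_iota ltn_ord.
case/imfsetP => i /=; rewrite mem_iota => /= lt_in ->.
by have := WA (Ordinal lt_in); rewrite tnth_mktuple /= kK.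
Qed.

Lemma window_stationary n k k' (B : set (n.-tuple R)) : measurable B ->
  pushforward P (window xi n k) B = pushforward P (window xi n k') B.
Proof.
apply: pushforward_rects_unique.
- exact: measurable_window.
- exact: measurable_window.
- by move=> A mA /=; rewrite !window_rect.
- by rewrite /= probability_setT ltry.
Qed.

(** As xi_(k+n) is independent of the window before it, it may be replaced by a separate draw from
    [mu]. This turns conditioning on the past into an inner integral under a product measure. *)
Lemma window_snoc n k (B : set (n.+1.-tuple R)) : measurable B ->
  pushforward (P \x mu)%E (fun z => snoc (window xi n k z.1) z.2) B =
  pushforward P (window xi n.+1 k) B.
Proof.
have mu_fin : (P \x mu)%E setT = 1%E.
  rewrite -setXTT product_measure1E//= (@probability_setT _ _ _ P).
  by rewrite (@probability_setT _ _ _ mu) mule1.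
apply: pushforward_rects_unique.
- apply: measurable_snoc => //.
  by apply: measurableT_comp => //; exact: measurable_window.
- exact: measurable_window.
- move=> A mA /=; rewrite window_rect// big_ord_recr /= -(window_rect n k mA).
  rewrite -product_measure1E//; last first.
    rewrite -[X in measurable X]setTI; apply: measurable_window => //.
    exact: measurable_rect.
  congr ((P \x mu)%E _); apply/seteqP; split=> [z /= zA|z /= [zA zn] i].
    split=> [i|].
      by have := zA (lift ord_max i); rewrite tnth_mktuple liftK lift_max.
    by have := zA ord_max; rewrite tnth_mktuple unlift_none.
  rewrite tnth_mktuple; case: (unliftP ord_max i) => [j|] ->; last exact: zn.
  by have := zA j; rewrite lift_max.
- by rewrite /= mu_fin ltry.
Qed.

End windows.

(** * Square integrable random variables *)

Section square_integrable.
Context d (T : measurableType d) (R : realType).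
Variable P : probability T R.
Implicit Type X : T -> R.

Lemma Lfun2_measurable X : X \in Lfun P 2%:E -> measurable_fun setT X.
Proof. by rewrite inE => /andP[/[!inE]]. Qed.

Lemma Lfun2P X : measurable_fun setT X ->
  (\int[P]_w (X w ^+ 2)%:E < +oo)%E -> X \in Lfun P 2%:E.
Proof.
move=> mX X2; rewrite inE; apply/andP; split; rewrite inE//=.
rewrite /finite_norm unlock poweR_lty//.
by under eq_integral => x _ do
  rewrite /= powR_mulrn// -normrX ger0_norm ?sqr_ge0//.
Qed.

Lemma Lfun2_lty X : X \in Lfun P 2%:E -> (\int[P]_w (X w ^+ 2)%:E < +oo)%E.
Proof. by move/Lfun2_integrable_sqr => X2; exact: integrable_lty X2. Qed.

Lemma Lfun21 X : X \in Lfun P 2%:E -> X \in Lfun P 1.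
Proof. by apply: Lfun_subset12; exact: fin_num_measure. Qed.

Lemma Lfun2_fin X : X \in Lfun P 2%:E -> 'E_P[X]%E \is a fin_num.
Proof. by move=> /Lfun21; exact: expectation_fin_num. Qed.

(** This is nonnegativity of the variance. *)
Lemma sqr_expectation_le X : X \in Lfun P 2%:E ->
  ('E_P[X] ^+ 2 <= \int[P]_w (X w ^+ 2)%:E)%E.
Proof.
move=> X2; have := variance_ge0 P X; rewrite varianceE//.
by rewrite suber_ge0 ?fin_numX ?Lfun2_fin// unlock.
Qed.

End square_integrable.

(** * Transfer of integrals between variables with the same law *)

Section same_law.
Context d1 d2 d (U1 : measurableType d1) (U2 : measurableType d2)
  (S : measurableType d) (R : realType).
Variables (m1 : {measure set U1 -> \bar R}) (m2 : {measure set U2 -> \bar R}).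
Variables (f1 : U1 -> S) (f2 : U2 -> S).
Hypotheses (mf1 : measurable_fun setT f1) (mf2 : measurable_fun setT f2).
Hypothesis f12 : forall B, measurable B ->
  pushforward m1 f1 B = pushforward m2 f2 B.

Lemma integral_same_law (G : S -> \bar R) : measurable_fun setT G ->
  (\int[m1]_x G (f1 x) = \int[m2]_x G (f2 x))%E.
Proof.
have ge0 (H : S -> \bar R) : measurable_fun setT H ->
    (forall x, (0 <= H x)%E) -> (\int[m1]_x H (f1 x) = \int[m2]_x H (f2 x))%E.
  move=> mH H0.
  have := @ge0_integral_pushforward _ _ _ _ _ _ mf1 m1 setT H measurableT mH.
  have := @ge0_integral_pushforward _ _ _ _ _ _ mf2 m2 setT H measurableT mH.
  rewrite !preimage_setT => <-// <-//.
  apply: (@eq_measure_integral _ _ _ _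
    (measure_function_pushforward__canonical__measure_function_Measure m2 mf2)
    (measure_function_pushforward__canonical__measure_function_Measure m1 mf1)).
  by move=> B mB _; exact: f12.
(* The nonnegative case is applied to the positive and the negative part. *)
move=> mG; rewrite integralE [in RHS]integralE; congr (_ - _)%E.
- transitivity (\int[m1]_x (G^\+ (f1 x)))%E.
    apply: eq_integral => x _; rewrite -[LHS]/((G \o f1)^\+ x)%E.
    by rewrite (funepos_comp G f1).
  rewrite (ge0 _ (measurable_funepos mG) (funepos_ge0 G)).
  apply: eq_integral => x _; rewrite -[RHS]/((G \o f2)^\+ x)%E.
  by rewrite (funepos_comp G f2).
- transitivity (\int[m1]_x (G^\- (f1 x)))%E.
    apply: eq_integral => x _; rewrite -[LHS]/((G \o f1)^\- x)%E.
    by rewrite (funeneg_comp G f1).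
  rewrite (ge0 _ (measurable_funeneg mG) (funeneg_ge0 G)).
  apply: eq_integral => x _; rewrite -[RHS]/((G \o f2)^\- x)%E.
  by rewrite (funeneg_comp G f2).
Qed.

Lemma integrable_same_law (G : S -> \bar R) : measurable_fun setT G ->
  m1.-integrable setT (G \o f1) -> m2.-integrable setT (G \o f2).
Proof.
move=> mG /integrableP[_ Glty]; apply/integrableP; split.
  exact: measurableT_comp.
have maG : measurable_fun setT (abse \o G) by exact: measurableT_comp.
by rewrite /= -(integral_same_law maG).
Qed.

End same_law.

(** * Conditional expectation given the past, as an integral over the last coordinate *)

Section conditional_expectation.
Context d (T : measurableType d) (R : realType) (P : probability T R).
Variable xi : int -> {RV P >-> R}.
Hypothesis xi_iid : iid xi.

Local Notation mu := (distribution P (xi 0)).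

Lemma integral_window_stationary n (k k' : int) (G : n.-tuple R -> \bar R) :
  measurable_fun [set: n.-tuple R] G ->
  (\int[P]_w G (window xi n k w) = \int[P]_w G (window xi n k' w))%E.
Proof.
by apply: integral_same_law => [||B mB];
  [exact: measurable_window|exact: measurable_window|exact: window_stationary].
Qed.

Lemma expectation_stationary n k k' (G : n.-tuple R -> R) :
  measurable_fun [set: n.-tuple R] G ->
  ('E_P[G \o window xi n k] = 'E_P[G \o window xi n k'])%E.
Proof.
move=> mG; rewrite unlock.
have mEG : measurable_fun [set: n.-tuple R] (EFin \o G).
  exact/measurable_EFinP.
exact: (integral_window_stationary _ _ mEG).
Qed.

Lemma measurable_comp_window n k (G : n.-tuple R -> R) :
  measurable_fun [set: n.-tuple R] G ->
  measurable_fun [set: T] (G \o window xi n k).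
Proof.
by move=> mG; apply: measurableT_comp => //; exact: measurable_window.
Qed.

Lemma Lfun2_stationary n k k' (G : n.-tuple R -> R) :
  measurable_fun [set: n.-tuple R] G ->
  G \o window xi n k \in Lfun P 2%:E -> G \o window xi n k' \in Lfun P 2%:E.
Proof.
move=> mG /Lfun2_lty Gk; apply: Lfun2P; first exact: measurable_comp_window.
have mG2 : measurable_fun [set: n.-tuple R] (fun x => (G x ^+ 2)%:E).
  by apply/measurable_EFinP; exact: measurable_funX.
by rewrite (integral_window_stationary k' k mG2).
Qed.

(* fine turns an undefined or infinite integral into the junk value 0; for
   square integrable f this affects a null set of x only. *)
Definition integrate_last n (f : n.+1.-tuple R -> R) (x : n.-tuple R) : R :=
  fine (\int[mu]_y (f (snoc x y))%:E).

Lemma measurable_snoc_comp n (f : n.+1.-tuple R -> R) :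
  measurable_fun [set: n.+1.-tuple R] f ->
  measurable_fun [set: n.-tuple R * R] (fun z => (f (snoc z.1 z.2))%:E).
Proof.
move=> mf; apply/measurable_EFinP; apply: (measurableT_comp mf).
exact: measurable_snoc.
Qed.

Lemma measurable_integrate_last n (f : n.+1.-tuple R -> R) :
  measurable_fun [set: n.+1.-tuple R] f ->
  measurable_fun [set: n.-tuple R] (integrate_last f).
Proof.
move=> mf; apply: measurableT_comp; first exact: fine_measurable.
have mf2 := measurable_snoc_comp mf.
pose F (z : n.-tuple R * R) := (f (snoc z.1 z.2))%:E.
(* Tonelli gives measurability of partial integrals of nonnegative functions, hence the split into
   positive and negative parts. *)
rewrite (_ : (fun _ => _) =
    (fun x => \int[mu]_y F^\+ (x, y) - \int[mu]_y F^\- (x, y))%E).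
  apply: emeasurable_funB.
    apply: (measurable_fun_fubini_tonelli_F (m2 := mu) F^\+%E) => //.
    exact: measurable_funepos.
  apply: (measurable_fun_fubini_tonelli_F (m2 := mu) F^\-%E) => //.
  exact: measurable_funeneg.
apply/funext => x; rewrite -[LHS]/(\int[mu]_y (F \o pair x) y)%E integralE.
by rewrite (funepos_comp F (pair x)) (funeneg_comp F (pair x)).
Qed.

Lemma sqr_integrate_last_le n (f : n.+1.-tuple R -> R) x :
  measurable_fun [set: n.+1.-tuple R] f ->
  ((integrate_last f x ^+ 2)%:E <= \int[mu]_y (f (snoc x y) ^+ 2)%:E)%E.
Proof.
(* An infinite right-hand side leaves nothing to show; otherwise the section is in L^2(mu), so
   [fine] does not alter its integral. *)
move=> mf; have [->|] := eqVneq (\int[mu]_y (f (snoc x y) ^+ 2)%:E)%E +oo%E.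
  exact: leey.
rewrite -ltey => f2.
have fx2 : (fun y => f (snoc x y)) \in Lfun mu 2%:E.
  apply: Lfun2P f2; apply: (measurableT_comp mf).
  by apply: measurable_snoc.
have := sqr_expectation_le fx2.
by have := Lfun2_fin fx2; rewrite unlock /integrate_last => /fineK <-.
Qed.

Lemma measurable_window_snoc n k :
  measurable_fun [set: T * R] (fun z => snoc (window xi n k z.1) z.2).
Proof.
apply: measurable_snoc => //.
by apply: measurableT_comp => //; exact: measurable_window.
Qed.

Lemma integrable_window_snoc n k (G : n.+1.-tuple R -> \bar R) :
  measurable_fun [set: n.+1.-tuple R] G ->
  P.-integrable setT (G \o window xi n.+1 k) ->
  (P \x mu)%E.-integrable setT (fun z => G (snoc (window xi n k z.1) z.2)).
Proof.
move=> mG; apply: integrable_same_law => // [||B mB].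
- exact: measurable_window.
- exact: measurable_window_snoc.
- by rewrite window_snoc.
Qed.

Lemma integral_window_snoc n k (G : n.+1.-tuple R -> \bar R) :
  measurable_fun [set: n.+1.-tuple R] G ->
  (\int[P]_w G (window xi n.+1 k w) =
   \int[P \x mu]_z G (snoc (window xi n k z.1) z.2))%E.
Proof.
move=> mG; apply: integral_same_law => // [||B mB].
- exact: measurable_window.
- exact: measurable_window_snoc.
- by rewrite window_snoc.
Qed.

(** Conditional expectation contracts L^2: the pointwise bound [sqr_integrate_last_le] is integrated
    over the prefix by Tonelli. *)
Lemma Lfun2_integrate_last n k (f : n.+1.-tuple R -> R) :
  measurable_fun [set: n.+1.-tuple R] f ->
  f \o window xi n.+1 k \in Lfun P 2%:E ->
  integrate_last f \o window xi n k \in Lfun P 2%:E.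
Proof.
move=> mf /Lfun2_lty f2; have mlast := measurable_integrate_last mf.
have mf2 : measurable_fun [set: n.+1.-tuple R] (fun x => (f x ^+ 2)%:E).
  by apply/measurable_EFinP; exact: measurable_funX.
have mG : measurable_fun [set: T * R]
    (fun z => (f (snoc (window xi n k z.1) z.2) ^+ 2)%:E).
  exact: (measurableT_comp mf2 (@measurable_window_snoc n k)).
apply: Lfun2P; first exact: measurable_comp_window.
apply: le_lt_trans f2.
rewrite (integral_window_snoc k mf2) fubini_tonelli1//; last first.
  by move=> z; rewrite lee_fin sqr_ge0.
apply: ge0_le_integral => //.
- by move=> w _; rewrite lee_fin sqr_ge0.
- apply/measurable_EFinP; apply: measurable_funX; exact: measurable_comp_window.
- apply: measurable_fun_fubini_tonelli_F => // z.
  by rewrite lee_fin sqr_ge0.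
- by move=> w _; exact: sqr_integrate_last_le.
Qed.

(** The characteristic property of conditional expectation, with [h] a test function of the past.
    The window of [f] is right-aligned with the window of length [n.+1] at [k]; [s1] places it
    there, and [s] places its first [m] coordinates. *)
Lemma expectation_integrate_last m n k k' (s : 'I_m -> 'I_n)
    (s1 : 'I_m.+1 -> 'I_n.+1) (h : n.-tuple R -> R) (f : m.+1.-tuple R -> R) :
  s1 ord_max = ord_max ->
  (forall i, s1 (lift ord_max i) = lift ord_max (s i)) ->
  (forall i : 'I_m.+1, k' + (i : nat)%:Z = k + (s1 i : nat)%:Z) ->
  measurable_fun [set: n.-tuple R] h -> measurable_fun [set: m.+1.-tuple R] f ->
  h \o window xi n k \in Lfun P 2%:E ->
  f \o window xi m.+1 k' \in Lfun P 2%:E ->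
  ('E_P[(h \o window xi n k) \* (f \o window xi m.+1 k')] =
   'E_P[(h \o window xi n k) \* (integrate_last f \o window xi m k')])%E.
Proof.
move=> s1M s1L ks mh mf h2 f2; rewrite unlock.
(* Both factors become one function of the window of length [n.+1] at [k], to which Fubini
   applies. *)
pose G (z : n.+1.-tuple R) := h (tinit z) * f (reindex_tuple s1 z).
have GE w : G (window xi n.+1 k w) =
    (h \o window xi n k) w * (f \o window xi m.+1 k') w.
  by rewrite /G tinit_window -(@window_reindex _ _ _ P xi _ _ k k' s1).
have Gsnoc w y : G (snoc (window xi n k w) y) =
    h (window xi n k w) * f (snoc (window xi m k' w) y).
  rewrite /G tinit_snoc (reindex_snoc _ _ s1M s1L).
  rewrite -(@window_reindex _ _ _ P xi _ _ k k' s)// => i.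
  by have := ks (lift ord_max i); rewrite s1L !lift_max.
have mG : measurable_fun [set: n.+1.-tuple R] (EFin \o G).
  apply/measurable_EFinP; apply: measurable_funM.
    by apply: measurableT_comp => //; exact: measurable_reindex_tuple.
  by apply: measurableT_comp => //; exact: measurable_reindex_tuple.
have mEf : measurable_fun [set: m.+1.-tuple R] (EFin \o f).
  exact/measurable_EFinP.
have iG : P.-integrable setT ((EFin \o G) \o window xi n.+1 k).
  have /Lfun1_integrable := Lfun2_mul_Lfun1 h2 f2.
  by apply: eq_integrable => // w _; rewrite /= GE.
have if1 : P.-integrable setT ((EFin \o f) \o window xi m.+1 k').
  by have /Lfun1_integrable := Lfun21 f2.
have iGprod := integrable_window_snoc mG iG.
transitivity (\int[P]_w (EFin \o G) (window xi n.+1 k w))%E.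
  by apply: eq_integral => w _; rewrite /= GE.
rewrite (integral_window_snoc k mG) -integral12_prod_meas1//.
apply: ae_eq_integral => //.
- exact: measurable_fubini_F iGprod.
- apply/measurable_EFinP.
  apply: measurable_funM; apply: measurable_comp_window => //.
  exact: measurable_integrate_last.
(* For almost every [w] the section of [f] is integrable; there [h] is a constant factor of the
   inner integral and [fine] is harmless. *)
have := ae_integrable1 (integrable_window_snoc mEf if1).
apply: filterS => w iw _; rewrite /fubini_F /=.
under eq_integral do rewrite Gsnoc EFinM.
rewrite integralZl// EFinM /integrate_last fineK//.
exact: integrable_fin_num.
Qed.

End conditional_expectation.

(** * Variance and covariance estimates *)

Section variance_complements.
Context d (T : measurableType d) (R : realType) (P : probability T R).
Implicit Types X Y M B : T -> R.

Lemma Lfun2D X Y : X \in Lfun P 2%:E -> Y \in Lfun P 2%:E ->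
  X \+ Y \in Lfun P 2%:E.
Proof. by move=> X2 Y2; rewrite rpredD ?lee1n. Qed.

Lemma Lfun2B X Y : X \in Lfun P 2%:E -> Y \in Lfun P 2%:E ->
  X \- Y \in Lfun P 2%:E.
Proof. by move=> X2 Y2; rewrite rpredB ?lee1n. Qed.

Lemma variance0_ae_cst X : X \in Lfun P 2%:E -> 'V_P[X]%E = 0%E ->
  {ae P, forall w, X w = fine 'E_P[X]%E}.
Proof.
move=> X2; rewrite /variance unlock; set c := fine _; rewrite unlock => VX0.
have mX := Lfun2_measurable X2.
have mXc : measurable_fun [set: T] (EFin \o (fun w => (X w - c) * (X w - c))).
  by apply/measurable_EFinP; apply: measurable_funM; apply: measurable_funB.
have /(ae_eq_integral_abs P measurableT mXc) :
    (\int[P]_w `|(EFin \o (fun w => (X w - c) * (X w - c))%R) w| = 0)%E.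
  rewrite -[RHS]VX0; apply: eq_integral => w _.
  by rewrite gee0_abs// lee_fin -expr2 sqr_ge0.
apply: filterS => w /(_ I) /= [] /eqP; rewrite mulf_eq0 orbb subr_eq0 => /eqP.
by [].
Qed.

Lemma norm_covariance_le X Y : X \in Lfun P 2%:E -> Y \in Lfun P 2%:E ->
  `|fine (covariance P X Y)| <=
  Num.sqrt (fine 'V_P[X]%E * fine 'V_P[Y]%E).
Proof.
(* Cauchy-Schwarz bounds the covariance from above; using it for [\- X] too bounds the absolute
   value. *)
have main (X1 Y1 : T -> R) : X1 \in Lfun P 2%:E -> Y1 \in Lfun P 2%:E ->
    fine (covariance P X1 Y1) <= Num.sqrt (fine 'V_P[X1]%E * fine 'V_P[Y1]%E).
  move=> X2 Y2; rewrite sqrtrM ?fine_ge0 ?variance_ge0//.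
  rewrite -lee_fin fineK ?covariance_fin_num ?Lfun2_mul_Lfun1 ?Lfun21//.
  have := covariance_le X2 Y2.
  rewrite -{1}(fineK (variance_fin_num X2)).
  by rewrite -{1}(fineK (variance_fin_num Y2)).
move=> X2 Y2; rewrite ler_norml main// andbT lerNl -(varianceN X2).
have NX2 : (\- X) \in Lfun P 2%:E by rewrite rpredN ?lee1n.
rewrite (_ : - _ = fine (covariance P (\- X) Y)); first exact: main.
by rewrite covarianceNl ?Lfun2_mul_Lfun1 ?Lfun21// fineN.
Qed.

(** Expanding the variance, [B] contributes at most C/n directly and, by Cauchy-Schwarz, 2 sqrt(n v
    C)/n through the covariance; both tend to 0. *)
Lemma limit_variance_bounded_perturbation (M B : nat -> T -> R) (v C : R) :
  (forall n, M n \in Lfun P 2%:E) -> (forall n, B n \in Lfun P 2%:E) ->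
  (forall n, 'V_P[M n] = (n%:R * v)%:E)%E ->
  (forall n, 'V_P[B n] <= C%:E)%E ->
  ((n%:R^-1)%:E * 'V_P[(M n \+ B n)%R])%E @[n --> \oo] --> v%:E.
Proof.
(* The shift avoids the division by 0 at n = 0 and turns the reciprocal into [harmonic n]. *)
move=> M2 B2 VM VB; rewrite -cvg_shiftS /=.
have v0 : 0 <= v by have := variance_ge0 P (M 1); rewrite VM lee_fin mul1r.
have C0 : 0 <= C by rewrite -lee_fin (le_trans (variance_ge0 P (B 0)))//.
pose s n := fine 'V_P[(M n \+ B n)%R]%E.
have sE n : 'V_P[(M n \+ B n)%R]%E = (s n)%:E.
  by rewrite fineK// variance_fin_num// Lfun2D.
under eq_fun do rewrite sE -EFinM.
apply: cvg_EFin; first exact: nearW.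
pose e n : R := harmonic n * C + 2 * (Num.sqrt (v * C) * Num.sqrt (harmonic n)).
have e_cvg : e n @[n --> \oo] --> (0 : R).
  rewrite [X in _ --> X](_ : _ =
      0 * C + 2 * (Num.sqrt (v * C) * Num.sqrt 0)); last first.
    by rewrite sqrtr0 !mulr0 mul0r addr0.
  apply: cvgD; first by apply: cvgMr_tmp; exact: cvg_harmonic.
  apply: cvgMl_tmp; apply: cvgMl_tmp.
  apply: (cvg_comp _ _ cvg_harmonic); exact: sqrt_continuous.
apply/cvgrPdist_le => /= eps eps0.
move/cvgrPdist_le : e_cvg => /(_ eps eps0); apply: filterS => n.
rewrite sub0r normrN; apply: le_trans.
have e0 : 0 <= e n by rewrite /e addr_ge0 ?mulr_ge0 ?sqrtr_ge0// invr_ge0.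
rewrite (ger0_norm e0).
have n0 : n.+1%:R != 0 :> R by rewrite pnatr_eq0.
have -> : s n.+1 = n.+1%:R * v + fine 'V_P[B n.+1]%E
    + 2 * fine (covariance P (M n.+1) (B n.+1)).
  apply: EFin_inj; rewrite -sE varianceD// VM [RHS]EFinD.
  rewrite (EFinD (_ * v)) (EFinM 2) !fineK ?variance_fin_num//.
  by rewrite covariance_fin_num ?Lfun2_mul_Lfun1 ?Lfun21.
rewrite -addrA mulrDr mulKf// opprD addNKr normrN mulrDr.
have VB0 : 0 <= fine 'V_P[B n.+1]%E by rewrite fine_ge0 ?variance_ge0.
have VBC : fine 'V_P[B n.+1]%E <= C.
  by rewrite -lee_fin fineK// variance_fin_num.
apply: (le_trans (ler_normD _ _)); rewrite /e lerD//.
  rewrite ger0_norm ?mulr_ge0 ?invr_ge0//.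
  by rewrite ler_wpM2l ?invr_ge0.
rewrite !normrM mulrCA (@ger0_norm _ 2)// ler_wpM2l// ger0_norm ?invr_ge0//.
apply: (le_trans (ler_wpM2l _ (norm_covariance_le (M2 _) (B2 _)))).
  by rewrite invr_ge0.
rewrite VM /= -sqrtrM ?mulr_ge0//.
(* The factor 1/(n+1) enters the root as its square; with the variance (n+1) v of [M n.+1] one power
   of 1/(n+1) remains. *)
rewrite -{1}[n.+1%:R^-1]ger0_norm ?invr_ge0// -sqrtr_sqr -sqrtrM ?sqr_ge0//.
rewrite ler_wsqrtr// /harmonic/=.
rewrite (_ : _ * (_ * _ * _) = v * fine 'V_P[B n.+1]%E / n.+1%:R).
  by rewrite ler_wpM2r ?invr_ge0// ler_wpM2l.
by rewrite expr2 -!mulrA mulKf// mulrC -mulrA.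
Qed.

End variance_complements.

(** * Decomposition into an innovation and a coboundary *)

Section innovations.
Context d (T : measurableType d) (R : realType) (P : probability T R).
Variable xi : int -> {RV P >-> R}.
Hypothesis xi_iid : iid xi.

(* D(xi_k', ..., xi_(k'+m)) has conditional mean zero given any window that
   ends at xi_(k'+m-1). *)
Definition innovation m (D : m.+1.-tuple R -> R) : Prop :=
  forall n (k k' : int) (h : n.-tuple R -> R),
    (m <= n)%N -> k + n%:Z = k' + m%:Z -> measurable_fun [set: n.-tuple R] h ->
    h \o window xi n k \in Lfun P 2%:E ->
    'E_P[(h \o window xi n k) \* (D \o window xi m.+1 k')]%E = 0%E.

Lemma shift_ord_subproof m n (i : 'I_m) : (m <= n)%N -> (i + (n - m) < n)%N.
Proof. by move=> le_mn; rewrite -{2}(subnKC le_mn) ltn_add2r. Qed.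

(** Locates the coordinates of a window of length [m] in the window of length [n] with the same
    right end. *)
Definition shift_ord m n (le_mn : (m <= n)%N) (i : 'I_m) : 'I_n :=
  Ordinal (shift_ord_subproof i le_mn).

(** Subtracting the conditional mean given the past leaves conditional mean zero, by
    [expectation_integrate_last] for right-aligned windows. *)
Lemma innovation_sub_integrate_last m (f : m.+1.-tuple R -> R) :
  measurable_fun [set: m.+1.-tuple R] f ->
  f \o window xi m.+1 0 \in Lfun P 2%:E ->
  innovation (fun x => f x - integrate_last xi f (tinit x)).
Proof.
move=> mf f2 n k k' h le_mn kn mh h2.
have f2' := Lfun2_stationary xi_iid k' mf f2.
have g2' := Lfun2_integrate_last xi_iid mf f2'.
rewrite (_ : _ \* _ = ((h \o window xi n k) \* (f \o window xi m.+1 k')) \-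
    ((h \o window xi n k) \* (integrate_last xi f \o window xi m k'))).
  rewrite expectationB; [|exact: Lfun2_mul_Lfun1|exact: Lfun2_mul_Lfun1].
  have le_mn1 : (m.+1 <= n.+1)%N by [].
  rewrite (@expectation_integrate_last _ _ _ _ _ xi_iid _ _ k k'
    (shift_ord le_mn) (shift_ord le_mn1))//.
  - by rewrite subee// expectation_fin_num// Lfun2_mul_Lfun1.
  - by apply/ord_inj => /=; rewrite subSS subnKC.
  - move=> i; apply/ord_inj; rewrite [RHS]lift_max.
    rewrite -[LHS]/((lift ord_max i : nat) + (n.+1 - m.+1))%N.
    by rewrite lift_max subSS.
  - by move=> i /=; move: kn le_mn; lia.
by apply/funext => w /=; rewrite mulrBr tinit_window.
Qed.

(** Ignoring the first coordinate amounts to starting at [k' + 1], with the right end unchanged. *)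
Lemma innovation_ttail m (D : m.+1.-tuple R -> R) :
  innovation D -> innovation (D \o @ttail R m.+1).
Proof.
move=> iD n k k' h le_mn kn mh h2.
rewrite -(iD n k (k' + 1) h (ltnW le_mn) _ mh h2); last by rewrite kn -addrA.
by congr expectation; apply/funext => w /=; rewrite ttail_window.
Qed.

Lemma innovationD m (D1 D2 : m.+1.-tuple R -> R) :
  measurable_fun [set: m.+1.-tuple R] D1 ->
  measurable_fun [set: m.+1.-tuple R] D2 ->
  D1 \o window xi m.+1 0 \in Lfun P 2%:E ->
  D2 \o window xi m.+1 0 \in Lfun P 2%:E ->
  innovation D1 -> innovation D2 -> innovation (D1 \+ D2).
Proof.
move=> mD1 mD2 D12 D22 iD1 iD2 n k k' h le_mn kn mh h2.
have D12' := Lfun2_stationary xi_iid k' mD1 D12.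
have D22' := Lfun2_stationary xi_iid k' mD2 D22.
rewrite (_ : _ \* _ = ((h \o window xi n k) \* (D1 \o window xi m.+1 k')) \+
    ((h \o window xi n k) \* (D2 \o window xi m.+1 k'))).
  by rewrite expectationD ?Lfun2_mul_Lfun1// iD1// iD2// adde0.
by apply/funext => w /=; rewrite mulrDr.
Qed.

Lemma measurable_comp_reindex m n (s : 'I_m -> 'I_n) (f : m.-tuple R -> R) :
  measurable_fun [set: m.-tuple R] f ->
  measurable_fun [set: n.-tuple R] (f \o reindex_tuple s).
Proof.
by move=> mf; apply: measurableT_comp => //; exact: measurable_reindex_tuple.
Qed.

(** Induction on [m]: [f] minus its average [g] over the last coordinate is an innovation, and [g]
    has one coordinate fewer, so the induction hypothesis splits it. *)
Lemma martingale_coboundary m (f : m.+1.-tuple R -> R) :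
  measurable_fun [set: m.+1.-tuple R] f ->
  f \o window xi m.+1 0 \in Lfun P 2%:E ->
  exists (D : m.+1.-tuple R -> R) (u : m.-tuple R -> R) (c : R),
  [/\ measurable_fun [set: m.+1.-tuple R] D /\
      measurable_fun [set: m.-tuple R] u,
      D \o window xi m.+1 0 \in Lfun P 2%:E,
      u \o window xi m 0 \in Lfun P 2%:E, innovation D &
      forall x, f x = c + D x + (u (tinit x) - u (ttail x))].
Proof.
elim: m f => [|m IH] f mf f2.
  (* With a single coordinate the average is a constant, its value at the only point of R^0, and no
     coboundary remains. *)
  exists (fun x => f x - integrate_last xi f (tinit x)), (cst 0),
    (integrate_last xi f [tuple]).
  have g2 := Lfun2_integrate_last xi_iid mf f2.
  have mg := measurable_integrate_last xi mf.
  split.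
  - split=> //; apply: measurable_funB => //; exact: measurable_comp_reindex.
  - apply: (Lfun2B f2); move: g2; rewrite (_ : _ \o _ =
      (fun w => integrate_last xi f (tinit (window xi 1 0 w))))//.
    by apply/funext => w /=; rewrite tinit_window.
  - exact: Lfun_cst.
  - exact: innovation_sub_integrate_last.
  - by move=> x; rewrite (tuple0 (tinit x)) subrr addr0 addrC subrK.
set g := integrate_last xi f.
have mg : measurable_fun [set: m.+1.-tuple R] g.
  exact: measurable_integrate_last.
have g2 : g \o window xi m.+1 0 \in Lfun P 2%:E.
  exact: Lfun2_integrate_last.
have [D [u [c [[mD mu] D2 u2 iD fE]]]] := IH _ mg g2.
have mfg : measurable_fun [set: m.+2.-tuple R] (fun x => f x - g (tinit x)).
  by apply: measurable_funB => //; exact: measurable_comp_reindex.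
have fg2 : (fun x => f x - g (tinit x)) \o window xi m.+2 0 \in Lfun P 2%:E.
  apply: (Lfun2B f2); move: g2; rewrite (_ : _ \o _ =
    (fun w => g (tinit (window xi m.+2 0 w))))//.
  by apply/funext => w /=; rewrite tinit_window.
have mDt : measurable_fun [set: m.+2.-tuple R] (D \o @ttail R m.+1).
  exact: measurable_comp_reindex.
have Dt2 : (D \o @ttail R m.+1) \o window xi m.+2 0 \in Lfun P 2%:E.
  have := Lfun2_stationary xi_iid 1 mD D2.
  rewrite (_ : _ \o _ = (D \o @ttail R m.+1) \o window xi m.+2 0)//.
  by apply/funext => w /=; rewrite ttail_window.
(* D sees only the first m+1 coordinates; moving it to the last m+1 costs the
   coboundary D (tinit x) - D (ttail x). *)
exists ((fun x => f x - g (tinit x)) \+ (D \o @ttail R m.+1)),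
  (D \+ (u \o @tinit R m)), c; split.
- split; first exact: measurable_funD.
  by apply: measurable_funD => //; exact: measurable_comp_reindex.
- exact: (Lfun2D fg2 Dt2).
- apply: (Lfun2D D2); move: u2; rewrite (_ : _ \o _ =
    (fun w => u (tinit (window xi m.+1 0 w))))//.
  by apply/funext => w /=; rewrite tinit_window.
- apply: innovationD => //; last exact: innovation_ttail.
  exact: innovation_sub_integrate_last.
(* Since [ttail] and [tinit] commute, the coboundary of [u] at [tinit x] is that of [u \o tinit] at
   [x]. *)
- move=> x /=; have := fE (tinit x); rewrite ttail_tinit => gE.
  rewrite gE; ring.
Qed.

End innovations.

(** * Orthogonality of innovations and the variance of their sums *)

Section sums_of_innovations.
Context d (T : measurableType d) (R : realType) (P : probability T R).
Variable xi : int -> {RV P >-> R}.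
Hypothesis xi_iid : iid xi.

Lemma partial_sum0 (X : int -> T -> R) : partial_sum X 0 = cst 0.
Proof. by apply/funext => w; rewrite /partial_sum big_geq. Qed.

Lemma partial_sumS (X : int -> T -> R) n :
  partial_sum X n.+1 = partial_sum X n \+ X n.+1%:Z.
Proof. by apply/funext => w; rewrite /partial_sum big_nat_recr. Qed.

Lemma Lfun2_partial_sum (X : int -> T -> R) n :
  (forall k, X k \in Lfun P 2%:E) -> partial_sum X n \in Lfun P 2%:E.
Proof.
move=> X2; elim: n => [|n IH]; first by rewrite partial_sum0 Lfun_cst.
by rewrite partial_sumS Lfun2D.
Qed.

Lemma variance_stationary n k k' (G : n.-tuple R -> R) :
  measurable_fun [set: n.-tuple R] G -> G \o window xi n k \in Lfun P 2%:E ->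
  ('V_P[G \o window xi n k] = 'V_P[G \o window xi n k'])%E.
Proof.
move=> mG G2; have G2' := Lfun2_stationary xi_iid k' mG G2.
rewrite !varianceE// (expectation_stationary xi_iid k k' mG); congr (_ - _)%E.
have mG2 : measurable_fun [set: n.-tuple R] (fun x => G x ^+ 2).
  exact: measurable_funX.
exact: (expectation_stationary xi_iid k k' mG2).
Qed.

Variables (m : nat) (D : m.+1.-tuple R -> R).
Hypotheses (mD : measurable_fun [set: m.+1.-tuple R] D)
  (D2 : D \o window xi m.+1 0 \in Lfun P 2%:E) (iD : innovation xi D).

Let Dk2 k : D \o window xi m.+1 k \in Lfun P 2%:E.
Proof. exact: Lfun2_stationary D2. Qed.

Lemma expectation_innovation k : 'E_P[D \o window xi m.+1 k]%E = 0%E.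
Proof.
(* The test function is the constant 1 on the window of the first [m] coordinates. *)
rewrite -(iD (k := k) (k' := k) (leqnn m) erefl (h := cst 1))//.
- by congr expectation; apply/funext => w /=; rewrite mul1r.
- exact: Lfun_cst.
Qed.

(** The earlier factor is a function of the window of length m+p+1 at [k], which ends just before
    the last coordinate of the later factor. *)
Lemma covariance_innovation (k : int) p :
  covariance P (D \o window xi m.+1 k)
    (D \o window xi m.+1 (k + p.+1%:Z)) = 0%E.
Proof.
rewrite covarianceE ?Lfun2_mul_Lfun1 ?Lfun21//.
rewrite !expectation_innovation mule0 sube0.
have le_mn : (m.+1 <= m + p.+1)%N by rewrite addnS ltnS leq_addr.
have hE : (D \o reindex_tuple (widen_ord le_mn)) \o window xi (m + p.+1) k =
    D \o window xi m.+1 k.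
  by apply/funext => w /=; rewrite -(@window_reindex _ _ _ P xi _ _ k k).
rewrite -hE; apply: iD; [by rewrite leq_addr|lia| |by rewrite hE].
exact: measurable_comp_reindex.
Qed.

Lemma covariance_partial_sum_innovation n k : (n < k)%N ->
  covariance P (partial_sum (block_factor D xi) n)
    (D \o window xi m.+1 k%:Z) = 0%E.
Proof.
elim: n => [|n IH] lt_nk; first by rewrite partial_sum0 covariance_cst_l.
rewrite partial_sumS covarianceDl;
  [|exact: Lfun2_partial_sum|exact: Dk2|exact: Dk2].
rewrite IH ?(ltn_trans _ lt_nk)// add0e.
(* The truncated subtraction is exact because [n.+1 < k], and it exhibits the lag as a successor. *)
rewrite (_ : k%:Z = n.+1%:Z + (k - n.+2).+1%:Z); last by lia.
exact: covariance_innovation.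
Qed.

Lemma variance_partial_sum_innovation n :
  'V_P[partial_sum (block_factor D xi) n]%E =
  (n%:R * fine 'V_P[D \o window xi m.+1 0])%:E.
Proof.
elim: n => [|n IH]; first by rewrite partial_sum0 variance_cst mul0r.
rewrite partial_sumS varianceD; [|exact: Lfun2_partial_sum|exact: Dk2].
rewrite covariance_partial_sum_innovation// mule0 adde0 IH.
rewrite [X in (_ + X)%E](@variance_stationary _ n.+1%:Z 0 D mD (Dk2 _)).
by rewrite -(fineK (variance_fin_num D2)) -EFinD mulrS mulrDl mul1r addrC.
Qed.

End sums_of_innovations.

(** * Vanishing limit variance forces a coboundary *)

Section coboundary.
Context d (T : measurableType d) (R : realType) (P : probability T R).
Variable xi : int -> {RV P >-> R}.
Hypothesis xi_iid : iid xi.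

(** By Cauchy-Schwarz the covariance of two variables of variance v is at least -v, so their
    difference has variance at most 2v + 2v. What matters is uniformity in [k] and [k']. *)
Lemma variance_window_sub_le m (u : m.-tuple R -> R) k k' :
  measurable_fun [set: m.-tuple R] u -> u \o window xi m 0 \in Lfun P 2%:E ->
  ('V_P[((u \o window xi m k) \- (u \o window xi m k'))%R] <=
   (4 * fine 'V_P[u \o window xi m 0]%E)%:E)%E.
Proof.
move=> mu u2.
have uk2 i : u \o window xi m i \in Lfun P 2%:E by exact: Lfun2_stationary u2.
set v := fine _; have v0 : 0 <= v by rewrite fine_ge0 ?variance_ge0.
have Vk i : 'V_P[u \o window xi m i]%E = v%:E.
  rewrite (variance_stationary xi_iid 0 mu (uk2 i)) fineK//.
  exact: variance_fin_num.
clearbody v; have := norm_covariance_le (uk2 k) (uk2 k').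
rewrite !Vk /= -expr2 sqrtr_sqr (ger0_norm v0) varianceB// !Vk.
rewrite -(@fineK _ (covariance _ _ _)); last first.
  by rewrite covariance_fin_num ?Lfun2_mul_Lfun1 ?Lfun21.
set c := fine (covariance _ _ _); rewrite ler_norml => /andP[cv _].
rewrite -[leLHS]/((v + v - 2 * c)%:E) lee_fin; move: cv => /=; lra.
Qed.

Lemma block_factor_coboundary m (f : m.+1.-tuple R -> R) :
  measurable_fun [set: m.+1.-tuple R] f ->
  block_factor f xi 0 \in Lfun P 2%:E ->
  limit_variance P (block_factor f xi) = 0%E ->
  exists2 g : m.-tuple R -> R, measurable_fun [set: m.-tuple R] g &
    forall n, {ae P, forall w,
      partial_sum (block_factor f xi) n w
        - fine 'E_P[partial_sum (block_factor f xi) n]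
      = g (window xi m n.+1%:Z w) - g (window xi m 1 w)}.
Proof.
move=> mf f2 lim0.
have [D [u [c [[mD mu] D2 u2 iD fE]]]] := martingale_coboundary xi_iid mf f2.
have uk2 k : u \o window xi m k \in Lfun P 2%:E by exact: Lfun2_stationary u2.
have Dk2 k : block_factor D xi k \in Lfun P 2%:E by exact: Lfun2_stationary D2.
pose M n := partial_sum (block_factor D xi) n.
(* The telescoped coboundary: only the windows at 1 and at n+1 survive. *)
pose U n := (u \o window xi m 1) \- (u \o window xi m n.+1%:Z).
pose B n := cst (n%:R * c) \+ U n.
have M2 n : M n \in Lfun P 2%:E by exact: Lfun2_partial_sum.
have U2 n : U n \in Lfun P 2%:E by exact: Lfun2B.
have B2 n : B n \in Lfun P 2%:E by rewrite Lfun2D ?Lfun_cst.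
have SE n : partial_sum (block_factor f xi) n = M n \+ B n.
  apply/funext => w; elim: n => [|n IH].
    by rewrite /M /B /U !partial_sum0 /= subrr mul0r !addr0.
  rewrite /M !partial_sumS /= IH /M /B /U /= /block_factor fE.
  rewrite tinit_window ttail_window.
  rewrite -[n.+1%:Z + 1]/(n.+1%:Z + 1%:Z) -PoszD addn1.
  by rewrite mulrS; ring.
have lim_v : ((n%:R^-1)%:E * 'V_P[(M n \+ B n)%R])%E @[n --> \oo] -->
    (fine 'V_P[D \o window xi m.+1 0]%E)%:E.
  apply: (@limit_variance_bounded_perturbation _ _ _ _ _ _ _
    (4 * fine 'V_P[u \o window xi m 0]%E)) => // n.
    exact: variance_partial_sum_innovation.
  by rewrite varianceD_cst_l// variance_window_sub_le.
(* By [lim_v] the limit exists, so [limn] returns it and not its default value. *)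
have v0 : fine 'V_P[D \o window xi m.+1 0]%E = 0.
  apply: EFin_inj; transitivity (limit_variance P (block_factor f xi)) => //.
  rewrite /limit_variance; under eq_fun do rewrite SE.
  by apply/esym/cvg_lim.
(* The sign is reversed because [U n] takes the window at 1 first and the conclusion takes the one
   at n+1 first. *)
exists (fun x => - u x); first exact: measurableT_comp.
move=> n.
have EU : 'E_P[U n]%E = 0%E.
  rewrite expectationB ?Lfun21// (expectation_stationary xi_iid _ 1 mu).
  by rewrite subee// Lfun2_fin.
have VM0 : 'V_P[M n]%E = 0%E.
  by rewrite variance_partial_sum_innovation// v0 mulr0.
(* [M n] equals its mean almost surely and [U n] has mean zero, so centring the sum leaves exactly
   [U n]. *)
have := variance0_ae_cst (M2 n) VM0; apply: filterS => w MwE.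
rewrite SE expectationD ?Lfun21// expectationD ?Lfun21 ?Lfun_cst//.
rewrite expectation_cst EU adde0 fineD ?Lfun2_fin//= MwE.
by rewrite /B /U /=; ring.
Qed.

End coboundary.

Theorem corollary1p7 (d : measure_display) (T : measurableType d)
    (R : realType) (P : probability T R)
    (l : nat) (l_ge1 : (1 <= l)%N)
    (xi : int -> {RV P >-> R}) (xi_iid : iid xi)
    (f : l.-tuple R -> R) (f_meas : measurable_fun [set: l.-tuple R] f)
    (X_var : forall k : int, finite_variance P (block_factor f xi k))
    (sigma2_eq0 : limit_variance P (block_factor f xi) = 0%E) :
  exists2 g : (l - 1)%N.-tuple R -> R,
    measurable_fun [set: (l - 1)%N.-tuple R] g &
    forall n : nat, (1 <= n)%N ->
      {ae P, forall w : T,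
        partial_sum (block_factor f xi) n w
          - fine 'E_P[partial_sum (block_factor f xi) n]
        = g (window xi (l - 1) (n.+1)%:Z w) - g (window xi (l - 1) 1 w)}.
Proof.
(* With [l] written as [m.+1], [l - 1] becomes [m], where [m] may be 0. *)
case: l => // m in l_ge1 f f_meas X_var sigma2_eq0 *.
have f2 : block_factor f xi 0 \in Lfun P 2%:E.
  apply: Lfun2P; first exact: measurable_comp_window.
  by have := X_var 0; rewrite /finite_variance unlock.
have [g mg gE] := block_factor_coboundary xi_iid f_meas f2 sigma2_eq0.
by rewrite subn1 /=; exists g => // n _; exact: gE.
Qed.
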